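(* Let $n\ge2$, and suppose that $G\times\mathbf{Q}_n\to\mathbf{Q}_n$ is a uniform quasisimilarity action of a group $G$: there exists $K\ge1$ such that each element of $G$ acts by a $K$-quasisimilarity. Suppose in addition that the induced action of $G$ on the space of distinct pairs in $\mathbf{Q}_n$ is cocompact. Then there is an ascending HNN decomposition $$G=\langle H,t\mid tht^{-1}=\phi(h),\ \forall h\in H\rangle,$$ where $H$ is a subgroup of $G$ and $t\in G$, such that $\phi\colon H\to H$ is a self-monomorphism with finite index image, and the action of $H$ on $\mathbf{Q}_n$ is uniformly bilipschitz.
   Context: For an integer $n\ge2$ (not necessarily prime), $\mathbf{Q}_n$ is the metric space of formal series $\xi=\sum_{i=k}^{+\infty}\xi_i n^i$ with $\xi_i\in\mathbf{Z}/n\mathbf{Z}$ and $k\in\mathbf{Z}$ (so $\xi$ is a sequence $(\xi_i)_{i\in\mathbf{Z}}$ with $\xi_i=0$ for all sufficiently negative $i$), with distance $d(\xi,\eta)=n^{-I}$ where $I$ is the greatest element of $\mathbf{Z}\cup\{+\infty\}$ such that $\xi_i=\eta_i$ for all $i\le I$. A $K$-quasisimilarity of a metric space $X$ is a bijection $f\colon X\to X$ such that $$\frac{d(f\zeta,f\omega)}{d(\zeta,\omega)}\Bigm/\frac{d(f\xi,f\eta)}{d(\xi,\eta)}\le K\quad\text{for all }\zeta\ne\omega,\ \xi\ne\eta\in X.$$ The action of $H$ is uniformly bilipschitz if there is $R\ge1$ such that $\frac1Rd(\xi,\eta)\le d(h\xi,h\eta)\le Rd(\xi,\eta)$ for all $h\in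 H$ and all $\xi,\eta$. The space of distinct pairs in $\mathbf{Q}_n$ is $\{(\xi,\eta)\in\mathbf{Q}_n\times\mathbf{Q}_n:\xi\ne\eta\}$. *)

(* Defs.v *)
From HB Require Import structures.
From mathcomp Require Import all_boot all_order all_algebra.
From mathcomp Require Import zify.
From mathcomp Require Import mathcomp_extra boolp classical_sets cardinality.
From mathcomp Require Import reals topology.

Set Implicit Arguments.
Unset Strict Implicit.
Unset Printing Implicit Defensive.

Import Order.TTheory GRing.Theory Num.Theory.

Local Open Scope classical_set_scope.
Local Open Scope ring_scope.

(* Formal series sum_{i >= k} xi_i n^i, given by their digits; there is no
   carrying, so equality is equality of digit sequences. The field [R] in which
   distances take their values and the proof [hn] are phantom parameters: they
   are needed to equip the type with its metric. As 1 < n, ['Z_n] is Z/nZ. *)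
Record Qn (R : realType) (n : nat) (hn : (1 < n)%N) := MkQn {
  digit :> int -> 'Z_n;
  digit_eventually0 : exists k : int, forall i, i < k -> digit i = 0 }.

HB.instance Definition _ R n hn := gen_eqMixin (@Qn R n hn).
HB.instance Definition _ R n hn := gen_choiceMixin (@Qn R n hn).

Section QnMetric.
Variables (R : realType) (n : nat) (hn : (1 < n)%N).
Implicit Types x y z : Qn R hn.

Definition agree_upto x y : set int :=
  [set I | forall i, i <= I -> x i = y i].

Definition is_greatest (A : set int) (I : int) : Prop :=
  A I /\ forall J, A J -> J <= I.

(* [I] is an actual greatest element as soon as [x != y], see [agreeP]; the
   default value 0 of [xget] is never used. *)
Definition Qn_dist x y : R :=
  if x == y then 0
  else n%:R ^ (- xget 0 [set I | is_greatest (agree_upto x y) I]).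

Lemma Qn_ext x y : (forall i, x i = y i) -> x = y.
Proof.
case: x y => [x hx] [y hy] /= /funext xy; subst y.
by congr MkQn; exact: Prop_irrelevance.
Qed.

Lemma agreeP x y : x != y ->
  is_greatest (agree_upto x y) (xget 0 [set I | is_greatest (agree_upto x y) I]).
Proof.
move=> xy.
suff [I hI] : exists I, is_greatest (agree_upto x y) I.
  by case: xgetP => [J _ //|/(_ I)].
have [k hk] : exists k : int, forall i, i < k -> x i = y i.
  have [a ha] := digit_eventually0 x; have [b hb] := digit_eventually0 y.
  exists (Num.min a b) => i; rewrite lt_min => /andP[/ha -> /hb ->] //.
have [i0 hi0] : exists i, x i != y i.
  apply/not_existsP => h; move/negP: xy; apply; apply/eqP/Qn_ext => i.
  by apply/eqP/negPn/negP => /h.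
have hex : exists m : nat, x (k + m%:Z) != y (k + m%:Z).
  exists `|i0 - k|%N.
  have ki0 : k <= i0.
    by rewrite leNgt; apply/negP => /hk e; move: hi0; rewrite e eqxx.
  by have -> : k + `|i0 - k|%N%:Z = i0 by lia.
case: (ex_minnP hex) => m hm mmin.
exists (k + m%:Z - 1); split => [i hi|J hJ].
  have [/hk//|ki] := ltP i k.
  apply/eqP/negPn/negP => ne.
  have := mmin `|i - k|%N.
  have -> : k + `|i - k|%N%:Z = i by lia.
  by move=> /(_ ne); lia.
rewrite leNgt; apply/negP => lJ.
have /hJ e : k + m%:Z <= J by lia.
by move: hm; rewrite e eqxx.
Qed.

Lemma Qn_distxx x : Qn_dist x x = 0.
Proof. by rewrite /Qn_dist eqxx. Qed.

Let n1 : 1 < n%:R :> R.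
Proof. by rewrite ltr1n. Qed.

Let n0 : 0 < n%:R :> R.
Proof. exact: lt_trans n1. Qed.

Lemma Qn_dist_ge0 x y : 0 <= Qn_dist x y.
Proof. by rewrite /Qn_dist; case: ifP => // _; rewrite exprz_ge0 ?ltW. Qed.

Lemma Qn_dist_eq0 x y : Qn_dist x y = 0 -> x = y.
Proof.
rewrite /Qn_dist; case: eqP => // _ /eqP.
by rewrite gt_eqF // exprz_gt0.
Qed.

Lemma Qn_dist_sym x y : Qn_dist x y = Qn_dist y x.
Proof.
rewrite /Qn_dist eq_sym; congr (if _ then _ else _ ^ (- xget _ _)).
suff -> : agree_upto x y = agree_upto y x by [].
by apply/seteqP; split => I h i /h.
Qed.

Lemma Qn_dist_ultra y x z :
  Qn_dist x z <= Num.max (Qn_dist x y) (Qn_dist y z).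
Proof.
have [->|xy] := eqVneq x y; first by rewrite le_max lexx orbT.
have [<-|yz] := eqVneq y z; first by rewrite le_max lexx.
have [->|xz] := eqVneq x z; first by rewrite Qn_distxx le_max Qn_dist_ge0.
have [[hxy _] [hyz _] [_ hxz]] := And3 (agreeP xy) (agreeP yz) (agreeP xz).
rewrite /Qn_dist (negPf xy) (negPf yz) (negPf xz).
move: (xget _ _) hxy (xget _ _) hyz (xget _ _) hxz => I hI J hJ M hM.
rewrite le_max !ler_eXz2l // !lerN2.
have [IJ|JI] := leP I J; apply/orP; [left|right]; apply: hM => i hi.
  by rewrite hI // hJ // (le_trans hi).
by rewrite hI ?hJ // (le_trans hi) // ltW.
Qed.

Lemma Qn_dist_triangle y x z : Qn_dist x z <= Qn_dist x y + Qn_dist y z.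
Proof.
rewrite (le_trans (Qn_dist_ultra y x z)) // ge_max.
by rewrite lerDl lerDr !Qn_dist_ge0.
Qed.

HB.instance Definition _ := isMetric.Build R (Qn R hn)
  Qn_distxx Qn_dist_eq0 Qn_dist_sym Qn_dist_triangle.

End QnMetric.

Definition is_action (G : groupType) (X : Type) (act : G -> X -> X) : Prop :=
  (forall x, act 1%g x = x) /\
  (forall g h x, act (g * h)%g x = act g (act h x)).

Section MetricActions.
Variables (R : realType) (X : metricType R).

Definition quasisimilarity (K : R) (f : X -> X) : Prop :=
  bijective f /\
  forall z w x y : X, z <> w -> x <> y ->
    (mdist (f z) (f w) / mdist z w) / (mdist (f x) (f y) / mdist x y) <= K.

Definition uniform_quasisimilarity_action (G : groupType) (act : G -> X -> X) :=
  is_action act /\ exists K : R, 1 <= K /\ forall g, quasisimilarity K (act g).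

Definition distinct_pairs : set (X * X) := [set p | p.1 <> p.2].

(* Compactness is intrinsic, so a compact subset of the space of distinct pairs
   is a compact subset of [X * X] contained in it. *)
Definition cocompact_on_distinct_pairs (G : groupType) (act : G -> X -> X) :=
  exists D : set (X * X),
    [/\ compact D, D `<=` distinct_pairs &
      forall p, distinct_pairs p ->
        exists g q, D q /\ p = (act g q.1, act g q.2)].

Definition uniformly_bilipschitz (H : Type) (act : H -> X -> X) : Prop :=
  exists L : R, 1 <= L /\ forall h x y,
    L^-1 * mdist x y <= mdist (act h x) (act h y) <= L * mdist x y.

End MetricActions.

Section Presentations.
Variable X : Type.

(* A letter is a generator together with a sign; [true] is exponent 1 and
   [false] is exponent -1. *)
Definition word := seq (X * bool).

(* The group presented by generators [X] and relations [rel] is the quotient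
   of the set of words by this congruence. *)
Inductive pres_eq (rel : word -> word -> Prop) : word -> word -> Prop :=
| pres_refl u : pres_eq rel u u
| pres_sym u v : pres_eq rel u v -> pres_eq rel v u
| pres_trans u v w : pres_eq rel u v -> pres_eq rel v w -> pres_eq rel u w
| pres_cat u u' v v' :
    pres_eq rel u u' -> pres_eq rel v v' -> pres_eq rel (u ++ v) (u' ++ v')
| pres_cancel x b : pres_eq rel [:: (x, b); (x, ~~ b)] [::]
| pres_rel u v : rel u v -> pres_eq rel u v.

Definition word_eval (G : groupType) (gen : X -> G) (w : word) : G :=
  (\prod_(l <- w) if l.2 then gen l.1 else (gen l.1)^-1)%g.

(* The canonical map from the presented group to [G] is well defined and
   bijective. *)
Definition has_presentation (G : groupType) (gen : X -> G)
    (rel : word -> word -> Prop) : Prop :=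
  (forall g, exists w, word_eval gen w = g) /\
  (forall u v, word_eval gen u = word_eval gen v <-> pres_eq rel u v).

End Presentations.

Section AscendingHNN.
Variables (H : groupType) (phi : H -> H).

(* The relations of <H, t | t h t^-1 = phi h>, including the multiplication
   table of [H]; the generators are [Some h] for [h : H], and [None] for t. *)
Inductive hnn_rel : word (option H) -> word (option H) -> Prop :=
| hnn_mul h k :
    hnn_rel [:: (Some h, true); (Some k, true)] [:: (Some (h * k)%g, true)]
| hnn_conj h :
    hnn_rel [:: (None, true); (Some h, true); (None, false)]
            [:: (Some (phi h), true)].

Definition finite_index (A : set H) : Prop :=
  finite_set (range (fun h : H => [set (h * a)%g | a in A])).

End AscendingHNN.

Definition ascending_hnn_decomposition (G : groupType) (S : {pred G})
    (H : subGroupType S) (t : G) (phi : H -> H) : Prop :=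
  has_presentation (fun x => if x is Some h then val h else t) (hnn_rel phi).

(* Main.v *)
(* Up to a bounded error each g in G shifts valuations (minus the logarithms of
   distances) by an integer sigma(g), and sigma is a quasimorphism. By local
   compactness the stabiliser U of a ball is commensurated in G, so there is a
   modular homomorphism
     Delta(g) = [U : U /\ gUg^-1] / [gUg^-1 : U /\ gUg^-1].
   Conjugating by strongly expanding elements shows that Delta is bounded, with
   finitely many values, on {|sigma| <= M}, and that it is bounded above on
   {sigma <= M}; cocompactness on distinct pairs makes it unbounded. Hence Delta
   has infinite cyclic image, generated by Delta(t) > 1, and controls sigma. The
   relations "x and y stay I-close under all g with Delta(g) >= 1" are comparable
   to the ultrametric closeness relations, invariant under ker Delta, and preserved
   by t. The subgroup H of those h in ker Delta that keep a base point x0 close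
   to itself, at a scale at which x0 and t x0 are close, satisfies t H t^-1 <= H
   with finite index, and ker Delta is the union of the t^-m H t^m. *)
Require Import Defs.
From HB Require Import structures.
From mathcomp Require Import all_boot all_order all_algebra.
From mathcomp Require Import zify lra.
From mathcomp Require Import boolp classical_sets cardinality reals topology.

Set Implicit Arguments.
Unset Strict Implicit.
Unset Printing Implicit Defensive.

Import Order.TTheory GRing.Theory Num.Theory.

Local Open Scope classical_set_scope.
Local Open Scope group_scope.

Ltac gsimp :=
  rewrite ?(invgM, invgK, invg1, mulgA, mulgK, mulgVK, mulgV, mulVg, mul1g, mulg1).

(** * Indices and the modular homomorphism *)

Section Index.
Variable G : groupType.
Implicit Types (A B C : set G) (g x y : G).

Definition is_subgroup A := A 1 /\ forall x y, A x -> A y -> A (x^-1 * y).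

Lemma subgroupV A x : is_subgroup A -> A x -> A x^-1.
Proof. by move=> [A1 AM] Ax; rewrite -[x^-1]mulg1; apply: AM. Qed.

Lemma subgroupM A x y : is_subgroup A -> A x -> A y -> A (x * y).
Proof.
move=> hA Ax Ay; rewrite -[x]invgK; apply: (hA.2) => //; exact: subgroupV.
Qed.

Lemma is_subgroupI A B : is_subgroup A -> is_subgroup B -> is_subgroup (A `&` B).
Proof.
move=> [A1 AM] [B1 BM]; split; first by split.
by move=> x y [Ax Bx] [Ay By]; split; [exact: AM|exact: BM].
Qed.

Definition conjs g A : set G := [set x | A (g^-1 * x * g)].

Lemma is_subgroup_conjs g A : is_subgroup A -> is_subgroup (conjs g A).
Proof.
move=> [A1 AM]; split; first by rewrite /conjs /=; gsimp.
move=> x y /= Ax Ay; rewrite /conjs /=.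
by have := AM _ _ Ax Ay; gsimp.
Qed.

Lemma conjs_mul g h A : conjs (g * h) A = conjs g (conjs h A).
Proof.
by apply/seteqP; split=> x; rewrite /conjs /=; gsimp.
Qed.

Lemma conjs1 A : conjs 1 A = A.
Proof. by apply/seteqP; split=> x; rewrite /conjs /=; gsimp. Qed.

Lemma conjsK g A : conjs g^-1 (conjs g A) = A.
Proof. by rewrite -conjs_mul mulVg conjs1. Qed.

(* Left transversals of [A `&` B] in [A]. *)
Definition transversal (T : finType) (f : T -> G) A B :=
  (forall i, A (f i)) /\ forall a, A a -> exists! i, B ((f i)^-1 * a).

Lemma leq_transversal (T T' : finType) (f : T -> G) (f' : T' -> G) A B :
  is_subgroup B -> transversal f A B -> transversal f' A B -> (#|T| <= #|T'|)%N.
Proof.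
move=> hB [fA fu] [fA' fu'].
pose c i := projT1 (cid (fu' _ (fA i))).
have cP i : B ((f' (c i))^-1 * f i).
  by rewrite /c; case: cid => j /= [].
apply: (@leq_card _ _ c) => i j cij.
have [l [Bl ul]] := fu _ (fA i).
rewrite -(ul i); last by rewrite mulVg; case: hB.
apply: ul.
have := hB.2 _ _ (cP j) (cP i); rewrite cij; gsimp; exact.
Qed.

Lemma card_transversal (T T' : finType) (f : T -> G) (f' : T' -> G) A B :
  is_subgroup B -> transversal f A B -> transversal f' A B -> #|T| = #|T'|.
Proof.
move=> hB hf hf'; apply/eqP; rewrite eqn_leq.
by rewrite (leq_transversal hB hf hf') (leq_transversal hB hf' hf).
Qed.

Definition has_index A B (m : nat) :=
  exists (T : finType) (f : T -> G), transversal f A B /\ #|T| = m.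

Definition finidx A B := exists m, has_index A B m.

(* The index of [A `&` B] in [A]; the default value 0 is only taken when this
   index is infinite. *)
Definition idx A B : nat := xget 0%N (has_index A B).

Lemma idxE A B m : is_subgroup B -> has_index A B m -> idx A B = m.
Proof.
move=> hB hm; rewrite /idx; case: xgetP => [k _|/(_ m)//].
case: hm => [T [f [hf <-]]] [T' [f' [hf' <-]]].
exact: card_transversal hf' hf.
Qed.

Lemma idxP A B : finidx A B -> has_index A B (idx A B).
Proof. by move=> [m hm]; rewrite /idx; case: xgetP => [k _//|/(_ m)]. Qed.

Lemma idx_gt0 A B : is_subgroup A -> finidx A B -> (0 < idx A B)%N.
Proof.
move=> hA /idxP [T [f [[fA fu] <-]]].
have [i _] := fu _ hA.1.
by apply/card_gt0P; exists i.
Qed.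

(** Upper bounds on indices come from here: a labelling with finitely many values that separates the
    cosets of [B] bounds their number, without exhibiting representatives. *)
Lemma idx_le (T : finType) (c : G -> T) A B : is_subgroup B ->
  (forall a b, A a -> A b -> c a = c b -> B (a^-1 * b)) ->
  finidx A B /\ (idx A B <= #|T|)%N.
Proof.
move=> hB hc.
pose p t := `[< exists a, A a /\ c a = t >].
pose T' := {t : T | p t}.
have ex (t : T') : {a | A a /\ c a = val t}.
  by apply: cid; apply/asboolP; exact: (valP t).
pose rep t := projT1 (ex t).
have repA t : A (rep t) by rewrite /rep; case: (ex t) => ? [].
have repc t : c (rep t) = val t by rewrite /rep; case: (ex t) => ? [].
(* distinct values of [c] may give the same coset: keep one value per coset *)
pose q (t : T') := [forall s : T', `[< B ((rep s)^-1 * rep t) >] ==>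
   (enum_rank t <= enum_rank s)%N].
pose T'' := {t : T' | q t}.
pose f (t : T'') := rep (val t).
have hf : transversal f A B.
  split=> [t|a Aa]; first exact: repA.
  have pa : p (c a) by apply/asboolP; exists a.
  pose t0 : T' := exist _ (c a) pa.
  have Bt0 : B ((rep t0)^-1 * a) by apply: hc => //; rewrite repc.
  pose P (t : T') := `[< B ((rep t)^-1 * a) >].
  have P0 : P t0 by apply/asboolP.
  case: (arg_minnP (fun t => nat_of_ord (enum_rank t)) P0) => t1 /asboolP Pt1 mint1.
  have q1 : q t1.
    apply/forallP => s; apply/implyP => /asboolP Bs; apply: mint1; apply/asboolP.
    by have := subgroupM hB Bs Pt1; gsimp.
  exists (exist _ t1 q1); split => // -[t2 q2]; rewrite /f /= => Bt2.
  apply/val_inj => /=; apply: enum_rank_inj; apply/val_inj/eqP => /=.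
  rewrite eqn_leq; apply/andP; split.
    by apply: mint1; apply/asboolP.
  move/forallP/(_ t1)/implyP: q2; apply; apply/asboolP.
  have := subgroupM hB Pt1 (subgroupV hB Bt2); gsimp; exact.
have fi : finidx A B by exists #|{: T''}|, T'', f.
split => //; rewrite (@idxE _ _ #|{: T''}|) //; last by exists T'', f.
by rewrite !card_sub; apply: leq_trans (max_card _) _; rewrite card_sub max_card.
Qed.

Lemma idx_ge (T : finType) (f : T -> G) A B : is_subgroup B -> finidx A B ->
  (forall i, A (f i)) -> (forall i j, B ((f i)^-1 * f j) -> i = j) ->
  (#|T| <= idx A B)%N.
Proof.
move=> hB /idxP [T' [f' [[fA' fu'] <-]]] fA finj.
pose c i := projT1 (cid (fu' _ (fA i))).
have cP i : B ((f' (c i))^-1 * f i).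
  by rewrite /c; case: cid => j /= [].
apply: (@leq_card _ _ c) => i j cij; apply: finj.
have := hB.2 _ _ (cP i) (cP j); rewrite cij; gsimp; exact.
Qed.

(** Products of representatives from the two stages are representatives for the whole: [f i] fixes
    the coset of [B], then [f' j] that of [C]. *)
Lemma has_index_tower A B C m k : is_subgroup A -> is_subgroup B ->
  has_index A B m -> has_index (A `&` B) C k -> has_index A (B `&` C) (m * k).
Proof.
move=> hA hB [T [f [[fA fu] <-]]] [T' [f' [[fA' fu'] <-]]].
exists (T * T')%type, (fun p => f p.1 * f' p.2); split; last by rewrite card_prod.
split=> [[i j] /=|a Aa]; first exact: subgroupM (fA i) (fA' j).1.
have [i [Bi ui]] := fu _ Aa.
have [j [Cj uj]] := fu' _ (conj (hA.2 _ _ (fA i) Aa) Bi).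
exists (i, j); split => /=.
  split; last by rewrite invgM -mulgA.
  by have := hB.2 _ _ (fA' j).2 Bi; gsimp.
move=> [i' j'] /= [Bij Cij].
have Bi' : B ((f i')^-1 * a).
  by have := subgroupM hB (fA' j').2 Bij; gsimp.
have ii := ui _ Bi'; subst i'; congr pair; apply: uj.
by rewrite mulgA -invgM.
Qed.

Lemma has_index_conj g A B m :
  has_index A B m -> has_index (conjs g A) (conjs g B) m.
Proof.
move=> [T [f [[fA fu] <-]]]; exists T, (fun i => g * f i * g^-1); split=> //.
split=> [i|a Aa]; first by rewrite /conjs /=; gsimp.
have [i [Bi ui]] := fu _ Aa; exists i; split.
  by move: Bi; rewrite /conjs /=; gsimp.
move=> j Bj; apply: ui; by move: Bj; rewrite /conjs /=; gsimp.
Qed.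

Lemma finidx_conj g A B : finidx A B -> finidx (conjs g A) (conjs g B).
Proof. by move=> [m /(has_index_conj g) ?]; exists m. Qed.

Lemma idx_conj g A B : is_subgroup B -> finidx A B ->
  idx (conjs g A) (conjs g B) = idx A B.
Proof.
move=> hB /idxP h; apply: idxE; first exact: is_subgroup_conjs.
exact: has_index_conj.
Qed.

Lemma finidxIl A B C : is_subgroup A -> is_subgroup B -> is_subgroup C ->
  finidx A C -> finidx (A `&` B) C.
Proof.
move=> hA hB hC [m [T [f [[fA fu] _]]]].
pose c a := if pselect (A a) is left Aa then Some (projT1 (cid (fu a Aa))) else None.
have [] // := @idx_le _ c (A `&` B) C hC.
move=> a b [Aa _] [Ab _]; rewrite /c; case: pselect => // Aa'; case: pselect => // Ab'.
case: cid => i [/= Bi _]; case: cid => j [/= Bj _] [ij]; subst j.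
by have := hC.2 _ _ Bi Bj; gsimp.
Qed.

Lemma idx_tower A B C : is_subgroup A -> is_subgroup B -> is_subgroup C ->
  finidx A B -> finidx A C ->
  idx A (B `&` C) = (idx A B * idx (A `&` B) C)%N.
Proof.
move=> hA hB hC fB fC; apply: idxE; first exact: is_subgroupI.
by apply: has_index_tower => //; apply: idxP => //; exact: finidxIl.
Qed.

Definition commensurated A := forall g, finidx A (conjs g A).

Lemma commensuratedP A g h : commensurated A -> finidx (conjs g A) (conjs h A).
Proof.
move=> cA; have := finidx_conj g (cA (g^-1 * h)).
by rewrite -conjs_mul mulgA mulgV mul1g.
Qed.

Local Open Scope ring_scope.

Definition modular A g : rat := (idx A (conjs g A))%:R / (idx (conjs g A) A)%:R.

(** The index of the triple intersection in each of the three groups is computed along two towers;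
    comparing the results gives this cocycle identity. *)
Lemma idx_commensurate A B C : is_subgroup A -> is_subgroup B -> is_subgroup C ->
  finidx A B -> finidx A C -> finidx B A -> finidx B C -> finidx C A -> finidx C B ->
  (idx A C)%:R / (idx C A)%:R =
   ((idx A B)%:R / (idx B A)%:R) * ((idx B C)%:R / (idx C B)%:R) :> rat.
Proof.
move=> hA hB hC AB AC BA BC CA CB.
have e1 := idx_tower hA hB hC AB AC.
have e1' := idx_tower hA hC hB AC AB.
have e2 := idx_tower hB hA hC BA BC.
have e2' := idx_tower hB hC hA BC BA.
have e3 := idx_tower hC hA hB CA CB.
have e3' := idx_tower hC hB hA CB CA.
rewrite (setIC C B) in e1'; rewrite (setIC C A) in e2'; rewrite (setIC B A) in e3'.
rewrite (setIC B A) in e2; rewrite (setIC C A) in e3; rewrite (setIC C B) in e3'.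
have := (idx_gt0 hA AB, idx_gt0 hA AC, idx_gt0 hB BA, idx_gt0 hB BC).
have := (idx_gt0 hC CA, idx_gt0 hC CB).
have := (idx_gt0 (is_subgroupI hA hB) (finidxIl hA hB hC AC),
   idx_gt0 (is_subgroupI hA hC) (finidxIl hA hC hB AB),
   idx_gt0 (is_subgroupI hB hC) (finidxIl hB hC hA BA)).
move: (idx A (B `&` C)) (idx B (A `&` C)) (idx C (A `&` B)) (idx A B) (idx B A)
  (idx A C) (idx C A) (idx B C) (idx C B) (idx (A `&` B) C) (idx (A `&` C) B)
  (idx (B `&` C) A) e1 e1' e2 e2' e3 e3' {AB AC BA BC CA CB}
  => a b c ab ba ac ca bc cb d e f -> e1' -> e2' -> e3' [[d0 e0] f0] [ca0 cb0]
  [[[ab0 ac0] ba0] bc0].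
have nz (x : nat) : (0 < x)%N -> (x%:R : rat) != 0 by rewrite pnatr_eq0 -lt0n.
apply/eqP; rewrite mulf_div eqr_div ?mulf_neq0 ?nz //.
rewrite -!natrM eqr_nat.
(* [d], [e], [f] are the indices of the triple intersection in the pairwise ones; after multiplying
   by them, both sides equal [a * b * c]. *)
rewrite -(@eqn_pmul2r (d * e * f)) ?muln_gt0 ?d0 ?e0 ?f0 //.
apply/eqP.
transitivity ((ac * e) * (ba * d) * (cb * f))%N; first by nia.
by rewrite -e1' e2' -e3'; nia.
Qed.

(** The cocycle identity for [A] and its conjugates by [g] and by [g * h]; indices are invariant
    under conjugation by [g]. *)
Lemma modularM A g h : is_subgroup A -> commensurated A ->
  modular A (g * h)%g = modular A g * modular A h.
Proof.
move=> hA cA; rewrite /modular.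
have hg k := is_subgroup_conjs k hA.
have c1 k : finidx (conjs k A) A by have := commensuratedP k 1%g cA; rewrite conjs1.
rewrite (@idx_commensurate A (conjs g A) (conjs (g * h)%g A)) //;
  try by (apply: commensuratedP || apply: cA).
by congr (_ * _); rewrite conjs_mul !idx_conj.
Qed.

Lemma modular_gt0 A g : is_subgroup A -> commensurated A -> 0 < modular A g.
Proof.
move=> hA cA; have := commensuratedP g 1%g cA; rewrite conjs1 => c1.
by rewrite divr_gt0 // ltr0n idx_gt0 //; exact: is_subgroup_conjs.
Qed.

End Index.

(** * Coarse similarity actions *)

Section CoarseSimilarity.
Local Open Scope ring_scope.
Variables (G : groupType) (X : Type) (act : G -> X -> X).
Hypothesis act1 : forall x, act 1%g x = x.
Hypothesis actM : forall g h x, act (g * h)%g x = act g (act h x).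

(* [cl I x y] stands for [d x y <= n ^ - I]; [sigma g] is the scale of [g] on the
   same logarithmic, order-reversing axis, so positive values are contractions. *)
Variable cl : int -> X -> X -> Prop.
Hypothesis cl_refl : forall I x, cl I x x.
Hypothesis cl_sym : forall I x y, cl I x y -> cl I y x.
Hypothesis cl_trans : forall I x y z, cl I x y -> cl I y z -> cl I x z.
Hypothesis clW : forall (I J : int) x y, cl I x y -> J <= I -> cl J x y.
Hypothesis cl_ex : forall x y, exists I, cl I x y.
(** Coarse local compactness; [cl_far] then provides arbitrarily many pairwise distant points. *)
Hypothesis cl_net : forall I J x, exists (m : nat) (p : 'I_m -> X),
  forall y, cl J x y -> exists i, cl I (p i) y.
Hypothesis cl_far : forall I (m : nat), exists z : 'I_m -> X,
  forall i j, cl I (z i) (z j) -> i = j.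

Variables (sigma : G -> int) (k : int).
Hypothesis k_ge0 : 0 <= k.
Hypothesis cl_act : forall g I x y,
  cl I x y -> cl (I + sigma g - k) (act g x) (act g y).
Hypothesis cl_actV : forall g I x y,
  cl I (act g x) (act g y) -> cl (I - sigma g - k) x y.

Variables x0 y0 : X.
Hypothesis cl_x0y0 : cl 0 x0 y0.
Hypothesis sep_x0y0 : ~ cl 1 x0 y0.

Variable M0 : int.
Hypothesis M0_ge0 : 0 <= M0.
(** The form in which cocompactness on distinct pairs is used: up to [M0], every ball is the image
    of the unit ball about [x0]. *)
Hypothesis cobounded : forall x (j : int), exists g,
  [/\ j - M0 <= sigma g, sigma g <= j + M0 & cl (j - M0) (act g x0) x].

(* The same product in [G] may be elaborated through different paths of the
   hierarchy, which [lia] does not identify. *)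
Ltac sigma_lia :=
  repeat match goal with H : is_true _ |- _ => revert H end;
  repeat match goal with |- context [sigma ?g] => move: (sigma g) => ? end;
  lia.

(** * The scale as a quasimorphism *)

Lemma cl_x0y0_le I : cl I x0 y0 -> I <= 0.
Proof.
move=> h; rewrite leNgt; apply/negP => I0; apply: sep_x0y0.
by apply: clW h _; lia.
Qed.

(** The pair [x0], [y0] is close at scale 0 and no finer. Pushing it forward by [g * h] and pulling
    it back through [g] and [h] costs one [k] per move. *)
Lemma sigmaM_le g h : sigma (g * h)%g <= sigma g + sigma h + 3 * k.
Proof.
have := cl_act (g * h)%g cl_x0y0; rewrite !actM.
by move=> /cl_actV /cl_actV /cl_x0y0_le; lia.
Qed.

Lemma sigmaM_ge g h : sigma g + sigma h <= sigma (g * h)%g + 3 * k.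
Proof.
have := cl_act g (cl_act h cl_x0y0); rewrite -!actM.
by move=> /cl_actV /cl_x0y0_le; lia.
Qed.

Lemma sigma1 : - k <= sigma 1%g <= k.
Proof.
have := cl_act 1%g cl_x0y0; rewrite !act1 => /cl_x0y0_le ?.
have : cl 0 (act 1%g x0) (act 1%g y0) by rewrite !act1.
by move=> /cl_actV /cl_x0y0_le ?; lia.
Qed.

Lemma sigmaV g : - sigma g - 4 * k <= sigma g^-1%g <= - sigma g + 4 * k.
Proof.
have := sigmaM_le g^-1%g g; have := sigmaM_ge g^-1%g g.
have -> : sigma (g^-1 * g)%g = sigma 1%g by rewrite mulVg.
by have := sigma1; lia.
Qed.

Lemma sigma_conj g u :
  sigma u - 10 * k <= sigma (g^-1 * u * g)%g <= sigma u + 10 * k.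
Proof.
have := sigmaM_le g^-1%g u; have := sigmaM_ge g^-1%g u.
have := sigmaM_le (g^-1 * u)%g g; have := sigmaM_ge (g^-1 * u)%g g.
by have := sigmaV g; sigma_lia.
Qed.

Lemma actKV g x : act g (act g^-1%g x) = x.
Proof. by rewrite -actM mulgV act1. Qed.

Lemma actVK g x : act g^-1%g (act g x) = x.
Proof. by rewrite -actM mulVg act1. Qed.

(** * The stabiliser of the unit ball and its commensurability *)

Definition stab : set G := [set u | forall x, cl 0 (act u x) x0 <-> cl 0 x x0].

Lemma stab_subgroup : is_subgroup stab.
Proof.
split=> [x|u v hu hv x]; first by rewrite act1.
rewrite actM; split.
  by move=> /hu; rewrite actKV => /hv.
by move=> /hv h; apply/hu; rewrite actKV.
Qed.

Lemma stab_x0 u : stab u -> cl 0 (act u x0) x0.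
Proof. by move=> hu; apply/hu. Qed.

(** [u] keeps both [x0] and [y0] in the unit ball, so it expands this pair by no more than the
    error. *)
Lemma stab_sigma_ge u : stab u -> - k <= sigma u.
Proof.
move=> hu; have h : cl 0 (act u y0) x0 by apply/hu/cl_sym.
have := cl_trans (stab_x0 hu) (cl_sym h).
by move=> /cl_actV /cl_x0y0_le; sigma_lia.
Qed.

Lemma stab_sigma u : stab u -> - k <= sigma u <= 5 * k.
Proof.
move=> hu; have := stab_sigma_ge hu.
have := stab_sigma_ge (subgroupV stab_subgroup hu).
by have := sigmaV u; sigma_lia.
Qed.

(** A coarse substitute for a compact subset of [G]. *)
Definition bounded_part (m d : int) : set G :=
  [set g | -m <= sigma g <= m /\ cl (- d) (act g x0) x0].

(* [g] is encoded by the trace of the image of the unit ball on a finite net. *)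
Lemma bounded_part_cosets m d : exists (T : finType) (c : G -> T),
  forall g g', bounded_part m d g -> bounded_part m d g' -> c g = c g' ->
    stab (g^-1 * g')%g.
Proof.
(* Points close at scale [|m| + k] remain 0-close when pulled back by an element of scale at most
   [m]. The second scale is that of a ball containing all images of the unit ball. *)
have [r [p hp]] := cl_net (`|m| + k) (- `|d| - `|m| - k) x0.
exists {set 'I_r}, (fun g => [set i | `[< cl 0 (act g^-1%g (p i)) x0 >]]%SET).
have key g g' z : bounded_part m d g -> bounded_part m d g' ->
    (forall i, cl 0 (act g'^-1%g (p i)) x0 -> cl 0 (act g^-1%g (p i)) x0) ->
    cl 0 z x0 -> cl 0 (act (g^-1 * g')%g z) x0.
  move=> [sg dg] [sg' dg'] cc hz.
  have [|i hi] := hp (act g' z).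
    apply: cl_sym; apply: cl_trans (clW (cl_act g' hz) _) (clW dg' _); sigma_lia.
  have hi' : cl 0 (act g'^-1%g (p i)) z.
    apply: clW (cl_actV (g := g') (I := `|m| + k) _) _; last sigma_lia.
    by rewrite actKV.
  have := cc i (cl_trans hi' hz); apply: cl_trans; rewrite actM.
  apply: clW (cl_actV (g := g) (I := `|m| + k) _) _; last sigma_lia.
  by rewrite !actKV; apply: cl_sym.
move=> g g' hg hg' cgg'.
have cE i : cl 0 (act g'^-1%g (p i)) x0 <-> cl 0 (act g^-1%g (p i)) x0.
  have := congr1 (fun s : {set 'I_r} => i \in s) cgg'; rewrite !inE => e.
  by split=> /asboolP h; apply/asboolP; move: h; rewrite e.
move=> x; split=> h.
  have := key g' g _ hg' hg (fun i => (cE i).2) h.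
  by rewrite -actM; gsimp; rewrite act1.
exact: key hg hg' (fun i => (cE i).1) h.
Qed.

(** The cosets are labelled through the conjugates [g^-1 * u * g], so it suffices that these lie in
    one bounded part. *)
Lemma idx_stab_le m d : exists C : nat, forall g,
  (forall u, stab u -> bounded_part m d (g^-1 * u * g)%g) ->
  finidx stab (conjs g stab) /\ (idx stab (conjs g stab) <= C)%N.
Proof.
have [T [c hc]] := bounded_part_cosets m d.
exists #|T| => g hg.
apply: (@idx_le _ _ (fun u => c (g^-1 * u * g)%g)).
  exact/is_subgroup_conjs/stab_subgroup.
move=> a b ha hb /hc /= /(_ (hg _ ha) (hg _ hb)).
by rewrite /conjs /=; gsimp.
Qed.

(** The bounds may depend on [g]: [u g x0] is compared with [g x0] by way of [u x0] and [x0], and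
    the result is pulled back by [g]. *)
Lemma stab_commensurated : commensurated stab.
Proof.
move=> g.
have [e he] := cl_ex (act g x0) x0.
have [C hC] := idx_stab_le (20 * k + 2 * `|sigma g|)
  (`|e| + 2 * `|sigma g| + 20 * k).
have [] // := hC g; move=> u hu.
have su := stab_sigma hu.
have := sigma_conj g u => hu'; split; first sigma_lia.
apply: clW (cl_actV (g := g) (I := - `|e| - `|sigma g| - 10 * k) _) _; last sigma_lia.
rewrite -actM; gsimp; rewrite actM.
apply: (@cl_trans _ _ x0); last by apply: cl_sym; apply: clW he _; sigma_lia.
apply: (@cl_trans _ _ (act u x0)); last by apply: clW (stab_x0 hu) _; sigma_lia.
by apply: clW (cl_act u he) _; sigma_lia.
Qed.

(** Here the bound is uniform: if [g] displaces [x0] by an amount comparable to its own scale,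
    pulling back by [g] leaves a displacement independent of [g]. The bound [M] absorbs the
    displacement of [x0] by [u], which has scale 0. *)
Lemma idx_stab_expand M D : exists C : nat, forall g, sigma g <= M ->
  cl (sigma g - D) (act g x0) x0 -> (idx stab (conjs g stab) <= C)%N.
Proof.
have [C hC] := idx_stab_le (20 * k) (`|D| + `|M| + 20 * k).
exists C => g gM gD; have [] // := hC g; move=> u hu.
have su := stab_sigma hu.
have := sigma_conj g u => hu'; split; first sigma_lia.
apply: clW (cl_actV (g := g) (I := sigma g - `|D| - `|M| - 10 * k) _) _; last sigma_lia.
rewrite -actM; gsimp; rewrite actM.
apply: (@cl_trans _ _ x0); last by apply: cl_sym; apply: clW gD _; sigma_lia.
apply: (@cl_trans _ _ (act u x0)); last by apply: clW (stab_x0 hu) _; sigma_lia.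
by apply: clW (cl_act u gD) _; sigma_lia.
Qed.

(** * The modular homomorphism and its bounds *)

Let Delta := modular stab.

Lemma DeltaM g h : Delta (g * h)%g = Delta g * Delta h.
Proof. by apply: modularM; [exact: stab_subgroup|exact: stab_commensurated]. Qed.

Lemma Delta_gt0 g : 0 < Delta g.
Proof. by apply: modular_gt0; [exact: stab_subgroup|exact: stab_commensurated]. Qed.

Lemma Delta1 : Delta 1%g = 1.
Proof.
have := DeltaM 1%g 1%g; rewrite mulg1 => /esym/eqP.
by rewrite -subr_eq0 -{3}[Delta 1%g]mulr1 -mulrBr mulf_eq0 gt_eqF ?Delta_gt0 //=
  subr_eq0 => /eqP.
Qed.

Lemma DeltaV g : Delta g^-1%g = (Delta g)^-1.
Proof.
apply: (mulIf (lt0r_neq0 (Delta_gt0 g))).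
by rewrite mulVf ?gt_eqF ?Delta_gt0 // -DeltaM mulVg Delta1.
Qed.

Lemma Delta_conj g h : Delta (h^-1 * g * h)%g = Delta g.
Proof. by rewrite !DeltaM DeltaV mulrAC mulVf ?mul1r // gt_eqF ?Delta_gt0. Qed.

(* Conjugating by a sufficiently expanding [h] brings the displacement of [x0]
   down to the order of magnitude of the scale of [g]. *)
Lemma conj_expand M g : 0 <= M -> sigma g <= M -> exists h,
  let g' := (h^-1 * g * h)%g in
  [/\ sigma g - 10 * k <= sigma g', sigma g' <= sigma g + 10 * k &
      cl (sigma g - M - 2 * M0 - 2 * k) (act g' x0) x0].
Proof.
move=> M_ge0 gM; have [e he] := cl_ex (act g x0) x0.
have [h [h1 h2 h3]] := cobounded x0 (- `|e|).
exists h => /=; have := sigma_conj h g => hg; split; [sigma_lia|sigma_lia|].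
apply: clW (cl_actV (g := h) (I := - `|e| + sigma g - M - M0 - k) _) _; last by lia.
rewrite -actM; gsimp; rewrite actM.
apply: (@cl_trans _ _ x0); last by apply: cl_sym; apply: clW h3 _; lia.
apply: (@cl_trans _ _ (act g x0)); last by apply: clW he _; lia.
by apply: clW (cl_act g h3) _; lia.
Qed.

(** [Delta] is conjugation invariant, so [g] may be replaced by the conjugate from [conj_expand], to
    which [idx_stab_expand] applies. Given a lower bound on the scale, it applies to the inverse as
    well and bounds the denominator. *)
Lemma Delta_frac M : exists C : nat, forall g, sigma g <= M ->
  exists a b : nat, [/\ Delta g = a%:R / b%:R, (0 < a <= C)%N, (0 < b)%N &
    - M <= sigma g -> (b <= C)%N].
Proof.
pose M' := `|M| + 10 * k.
have [C hC] := idx_stab_expand (M' + 4 * k) (4 * M' + 2 * M0 + 20 * k).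
exists C => g gM; have [||h [/= h1 h2 h3]] := @conj_expand M' g; [sigma_lia|sigma_lia|].
rewrite -(Delta_conj g h); set g' := (h^-1 * g * h)%g in h1 h2 h3 *.
have hs := stab_subgroup; have cs := stab_commensurated.
have cs' : finidx (conjs g' stab) stab.
  by have := commensuratedP g' 1%g cs; rewrite conjs1.
exists (idx stab (conjs g' stab)), (idx (conjs g' stab) stab); split => //.
- rewrite idx_gt0 //=; apply: hC; first sigma_lia.
  by apply: clW h3 _; sigma_lia.
- by rewrite idx_gt0 //; exact: is_subgroup_conjs.
move=> Mg.
rewrite -(@idx_conj _ g'^-1%g) // conjsK.
have := sigmaV g' => sV.
apply: hC; first sigma_lia.
apply: cl_sym; apply: clW (cl_actV (g := g') (I := - 4 * M' - 2 * M0 - 8 * k) _) _.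
  by rewrite actKV; apply: clW h3 _; sigma_lia.
by sigma_lia.
Qed.

Lemma Delta_le M : exists C : nat, forall g, sigma g <= M -> Delta g <= C%:R.
Proof.
have [C hC] := Delta_frac M; exists C => g /hC [a [b [-> /andP[_ aC] b0 _]]].
rewrite ler_pdivrMr ?ltr0n // -natrM ler_nat.
by rewrite (leq_trans aC) // leq_pmulr.
Qed.

Lemma pigeonhole (T : finType) (L m : nat) (f : 'I_m -> T) :
  (#|T| * L < m)%N -> exists t, (L < #|[set i | f i == t]%SET|)%N.
Proof.
move=> h; apply/existsP; apply: contraTT h; rewrite negb_exists -leqNgt => /forallP h.
have -> : m = (\sum_t #|[set i | f i == t]%SET|)%N.
  rewrite -[LHS]card_ord -sum1_card (partition_big f xpredT) //=.
  apply: eq_bigr => t _; rewrite -sum1_card.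
  by apply: eq_bigl => i; rewrite !inE.
by rewrite -sum_nat_const leq_sum // => t _; have := h t; rewrite -leqNgt.
Qed.

(** The [g i] take [x0] to pairwise distant points, all within reach of [h x0] on the scale of [h].
    By pigeonhole, many products [g i * (g i0)^-1] lie in the conjugate of [stab] by [h], in
    distinct cosets of its conjugate by [g i0], while the opposite index stays bounded. *)
Lemma Delta_unbounded (C : nat) : exists g, C%:R < Delta g.
Proof.
have [T [c hc]] := bounded_part_cosets (4 * M0 + 40 * k) (4 * M0 + 20 * k).
have [C1 hC1] := idx_stab_expand (4 * M0 + 20 * k) (8 * M0 + 20 * k).
(* More than [C * C1] cosets against an opposite index of at most [C1] force a ratio above [C]. *)
pose L := (C * C1)%N.
(* The separation exceeds both the error [M0] of [g i x0] as an approximation of [z i] and the size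
   of the image of the unit ball under [g i]. *)
have [z hz] := cl_far (- M0 - k) (#|T| * L).+1.
have /choice [g hg] := fun i => cobounded (z i) 0.
have [e [e0 he]] : exists e, e <= 0 /\ forall i, cl e x0 (z i).
  have /choice [e he] := fun i => cl_ex x0 (z i).
  exists (- \sum_i `|e i|); split; first by rewrite oppr_le0 sumr_ge0.
  move=> i; apply: clW (he i) _; rewrite (bigD1 i) //=.
  have : 0 <= \sum_(j | j != i) `|e j| by rewrite sumr_ge0.
  by move: (\sum_(j | _) _) => s; lia.
have [h [h1 h2 h3]] := cobounded x0 e.
have hgx i : cl (e - M0) (act h x0) (act (g i) x0).
  have [a1 a2 a3] := hg i.
  apply: cl_trans h3 _; apply: (@cl_trans _ _ (z i)); first by apply: clW (he i) _; sigma_lia.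
  by apply: cl_sym; apply: clW a3 _; sigma_lia.
have gh i : cl (e - 2 * M0 - k) (act ((g i)^-1 * h)%g x0) x0.
  have [a1 a2 a3] := hg i.
  apply: clW (cl_actV (g := g i) (I := e - M0) _) _; last sigma_lia.
  by rewrite -actM mulgA mulgV mul1g.
(* Conjugating by [h] makes the displacement bounded; [g ord0] cancels in [(w i)^-1 * w i0]. *)
pose w i := (h^-1 * g ord0 * (g i)^-1 * h)%g.
have hw i : bounded_part (4 * M0 + 40 * k) (4 * M0 + 20 * k) (w i).
  have [a1 a2 a3] := hg i; have [b1 b2 b3] := hg ord0.
  have := (sigmaM_le h^-1%g (g ord0), sigmaM_ge h^-1%g (g ord0), sigmaV h,
    sigmaM_le (h^-1 * g ord0)%g (g i)^-1%g, sigmaM_ge (h^-1 * g ord0)%g (g i)^-1%g).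
  move=> [[[[c1 c2] c3] c4] c5].
  have := (sigmaV (g i), sigmaM_le (h^-1 * g ord0 * (g i)^-1)%g h,
    sigmaM_ge (h^-1 * g ord0 * (g i)^-1)%g h) => -[[c6 c7] c8].
  split; first by rewrite /w; sigma_lia.
  apply: clW (cl_actV (g := h) (I := e - 3 * M0 - 2 * k) _) _; last sigma_lia.
  rewrite -actM /w !mulgA mulgV mul1g -mulgA actM.
  apply: (@cl_trans _ _ (act (g ord0) x0)).
    by apply: clW (cl_act (g ord0) (gh i)) _; sigma_lia.
  by apply: cl_sym; apply: clW (hgx ord0) _; sigma_lia.
have [|t ht] := @pigeonhole T L _ (fun i => c (w i)); first exact: ltnSn.
set S := [set i | _]%SET in ht.
have [i0 i0S] : exists i0, i0 \in S by apply/card_gt0P; apply: leq_trans ht.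
pose f := ((g i0)^-1 * h)%g.
have sub := stab_subgroup; have com := stab_commensurated.
have fS : (L < idx (conjs f stab) stab)%N.
  have com' : finidx (conjs f stab) stab.
    by have := commensuratedP f 1%g com; rewrite conjs1.
  apply: leq_trans ht _.
  rewrite -(@idx_conj _ (g i0)) // -conjs_mul /f mulgA mulgV mul1g.
  have -> : #|S| = #|{: {i | i \in S}}| by rewrite card_sig; apply: eq_card => i; rewrite inE.
  apply: (@idx_ge _ _ (fun i : {i | i \in S} => g (val i) * (g i0)^-1)%g).
  - exact: is_subgroup_conjs.
  - by apply: commensuratedP.
  - move=> [i iS] /=; have : c (w i) = c (w i0).
      by move: iS i0S; rewrite !inE => /eqP -> /eqP ->.
    by move=> /(hc _ _ (hw i) (hw i0)); rewrite /w /conjs /=; gsimp.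
  move=> [i iS] [j jS]; rewrite /conjs /=; gsimp => hij.
  apply/val_inj/hz => /=.
  have [a1 a2 a3] := hg i; have [b1 b2 b3] := hg j.
  apply: (@cl_trans _ _ (act (g i) x0)); first by apply: cl_sym; apply: clW a3 _; sigma_lia.
  apply: (@cl_trans _ _ (act (g j) x0)); last by apply: clW b3 _; sigma_lia.
  have := cl_act (g i) (stab_x0 hij); rewrite -actM mulgA mulgV mul1g.
  by move=> /cl_sym /clW; apply; sigma_lia.
have fC : (idx stab (conjs f stab) <= C1)%N.
  have [a1 a2 a3] := hg i0.
  have := (sigmaV (g i0), sigmaM_le (g i0)^-1%g h) => -[c6 c7].
  apply: hC1; first by rewrite /f; sigma_lia.
  by apply: clW (gh i0) _; rewrite /f; sigma_lia.
exists f^-1%g; rewrite DeltaV /Delta /modular invf_div.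
have f0 := idx_gt0 sub (com f).
rewrite ltr_pdivlMr ?ltr0n // -natrM ltr_nat; apply: leq_ltn_trans fS.
by rewrite leq_mul2l fC orbT.
Qed.

(** If the scale of [g] were very negative, [f * g] would still have non-positive scale, but [Delta]
    above the bound [C2] valid there. *)
Lemma Delta_sigma_ge : exists C : int, 0 <= C /\ forall g, 1 <= Delta g -> - C <= sigma g.
Proof.
have [C2 hC2] := Delta_le 0.
have [f hf] := Delta_unbounded C2.
exists (`|sigma f| + 3 * k); split=> [|g g1]; first sigma_lia.
rewrite leNgt; apply/negP => sg.
have := sigmaM_le f g => sfg.
have : Delta (f * g)%g <= C2%:R by apply: hC2; sigma_lia.
rewrite DeltaM; apply/negP; rewrite -ltNge (lt_le_trans hf) //.
by rewrite ler_peMr // ltW // Delta_gt0.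
Qed.

Lemma Delta_sigma_le (L : rat) : exists C : int, forall g, Delta g <= L -> sigma g <= C.
Proof.
have [C [C0 hC]] := Delta_sigma_ge.
have [f hf] : exists f, L <= Delta f.
  have [f hf] := Delta_unbounded (Num.bound `|L|).
  exists f; apply: le_trans (ltW hf); apply: le_trans (ler_norm _) (ltW _).
  exact/archi_boundP/normr_ge0.
exists (C + 10 * k + sigma f) => g gL.
have : - C <= sigma (f * g^-1)%g.
  by apply: hC; rewrite DeltaM DeltaV ler_pdivlMr ?Delta_gt0 // mul1r (le_trans gL).
by have := sigmaM_le f g^-1%g; have := sigmaV g; sigma_lia.
Qed.

(** Where [1 < Delta g <= L], the scale is bounded on both sides, so [Delta] takes only finitely
    many values, fractions with numerator and denominator at most [C]; the least one is attained. *)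
Lemma Delta_generator : exists t, 1 < Delta t /\
  forall g, 1 < Delta g -> Delta t <= Delta g.
Proof.
have [f] := Delta_unbounded 1; set L := Delta f => L1.
have [C1 [C10 hC1]] := Delta_sigma_ge.
have [C2 hC2] := Delta_sigma_le L.
have [C hC] := Delta_frac (C1 + `|C2|).
have hfrac g : 1 < Delta g <= L -> exists a b : 'I_C.+1, Delta g = a%:R / b%:R.
  move=> /andP[g1 gL]; have := hC1 _ (ltW g1); have := hC2 _ gL => s1 s2.
  have [|a [b [e /andP[_ aC] _ bC]]] := hC g; first sigma_lia.
  have aC' : (a < C.+1)%N by [].
  have bC' : (b < C.+1)%N by apply: bC; sigma_lia.
  by exists (Ordinal aC'), (Ordinal bC').
pose P (p : 'I_C.+1 * 'I_C.+1) := `[< exists g, 1 < Delta g <= L /\ Delta g = p.1%:R / p.2%:R >].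
have [a0 [b0 e0]] := hfrac f (introT andP (conj L1 (lexx _))).
have P0 : P (a0, b0) by apply/asboolP; exists f; rewrite L1 lexx.
case: (arg_minP (fun p : 'I_C.+1 * 'I_C.+1 => p.1%:R / p.2%:R : rat) P0) => p /asboolP [t [/andP[t1 tL] et]] pmin.
exists t; split=> // g g1.
have [gL|/ltW Lg] := leP (Delta g) L; last exact: le_trans Lg.
have [|a [b e]] := hfrac g; first by rewrite g1.
rewrite et e; apply: (pmin (a, b)); apply/asboolP; exists g.
by rewrite g1 gL.
Qed.

Lemma exp_unbounded (x y : rat) : 1 < x -> exists m : nat, y < x ^+ m.
Proof.
move=> x1; pose e := x - 1; have e0 : 0 < e by rewrite subr_gt0.
have bern m : 1 + e *+ m <= x ^+ m.
  elim: m => [|m IH]; first by rewrite mulr0n addr0 expr0.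
  rewrite exprSr -{2}[x](subrK 1) -/e mulrSr mulrDr mulr1 addrA [leRHS]addrC lerD //.
  by rewrite ler_peMl ?(ltW e0) // exprn_ege1 // ltW.
exists (Num.bound `|y / e|); apply: lt_le_trans (bern _).
rewrite -[e *+ _]mulr_natl.
have : y / e < (Num.bound `|y / e|)%:R.
  by apply: le_lt_trans (ler_norm _) _; exact/archi_boundP/normr_ge0.
rewrite ltr_pdivrMr // => /lt_trans; apply; lra.
Qed.


(* Since [sigma] is only a quasimorphism, [cl] is preserved by contractions up to
   an error; taking all [g] with [1 <= Delta g] at once removes it. *)
Definition contracted_cl (I : int) x y :=
  forall g, 1 <= Delta g -> cl I (act g x) (act g y).

Lemma contracted_clW I x y : contracted_cl I x y -> cl I x y.
Proof. by move=> /(_ 1%g); rewrite Delta1 lexx !act1; apply. Qed.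

Lemma contracted_cl_sym I x y : contracted_cl I x y -> contracted_cl I y x.
Proof. by move=> h g g1; apply/cl_sym/h. Qed.

Lemma contracted_cl_trans I x y z :
  contracted_cl I x y -> contracted_cl I y z -> contracted_cl I x z.
Proof. by move=> h h' g g1; apply: cl_trans (h _ g1) (h' _ g1). Qed.

Lemma contracted_cl_act I g x y : 1 <= Delta g ->
  contracted_cl I x y -> contracted_cl I (act g x) (act g y).
Proof.
move=> g1 h f f1; rewrite -!actM; apply: h.
by rewrite DeltaM -[1]mulr1 ler_pM.
Qed.

(** Elements with [Delta] at least 1 expand by at most a fixed amount. *)
Lemma contracted_cl_of_cl :
  exists C : int, forall I x y, cl (I + C) x y -> contracted_cl I x y.
Proof.
have [C [_ hC]] := Delta_sigma_ge.
exists (C + k) => I x y h g /hC gC.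
by apply: clW (cl_act g h) _; sigma_lia.
Qed.

(** * Powers of the generator and the coarse decomposition *)

Lemma DeltaX t m : Delta (t ^+ m)%g = Delta t ^+ m.
Proof. by elim: m => [|m IH]; rewrite ?Delta1 // expgS DeltaM IH exprS. Qed.

(** Dividing by the largest power of [Delta t] not above [Delta g] leaves a value in [[1, Delta t)],
    hence 1 by minimality. *)
Lemma Delta_power t : 1 < Delta t -> (forall g, 1 < Delta g -> Delta t <= Delta g) ->
  forall g, 1 <= Delta g -> exists m, Delta g = Delta t ^+ m.
Proof.
move=> t1 tmin g g1.
have [m mg mmin] := ex_minnP (exp_unbounded (Delta g) t1).
case: m mg mmin => [|m] mg mmin; first by move: mg; rewrite expr0 ltNge g1.
exists m.
have gm : Delta t ^+ m <= Delta g.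
  by rewrite leNgt; apply/negP => /mmin; rewrite ltnn.
have t0 := exprn_gt0 m (Delta_gt0 t).
have e : Delta (g * (t ^+ m)^-1)%g = Delta g / Delta t ^+ m.
  by rewrite DeltaM DeltaV DeltaX.
have [/tmin|] := ltP 1 (Delta (g * (t ^+ m)^-1)%g).
  rewrite e ler_pdivlMr // -exprS => /le_lt_trans /(_ mg); by rewrite ltxx.
rewrite e ler_pdivrMr // mul1r => gm'; by apply/eqP; rewrite eq_le gm' gm.
Qed.

(** The clauses provide, in order, the group [H], the map [phi], uniqueness of exponents, existence
    of normal forms, finite index of the image and the bilipschitz bound. *)
Theorem coarse_hnn : exists (S : set G) (t : G),
  [/\ is_subgroup S,
      (forall h, S h -> S (t * h * t^-1)%g),
      (forall m, S (t ^+ m)%g -> m = 0%N) &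
      [/\ (forall g, exists a b h, S h /\ g = ((t ^+ a)^-1 * h * t ^+ b)%g),
          (exists (T : finType) (c : G -> T), forall h h', S h -> S h' -> c h = c h' ->
             S (t^-1 * (h^-1 * h') * t)%g) &
          exists C : int, forall h, S h -> `|sigma h| <= C]].
Proof.
have [t [t1 tmin]] := Delta_generator.
have [C hC] := contracted_cl_of_cl.
have [rho hrho] : exists rho, contracted_cl rho x0 (act t x0).
  have [I hI] := cl_ex x0 (act t x0).
  by exists (I - C); apply: hC; rewrite subrK.
pose S : set G := [set h | Delta h = 1 /\ contracted_cl rho (act h x0) x0].
have SV h : S h -> S h^-1%g.
  move=> [h1 hx]; split; first by rewrite DeltaV h1 invr1.
  have := @contracted_cl_act _ h^-1%g _ _ _ hx; rewrite actVK DeltaV h1 invr1 lexx.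
  by move=> /(_ isT)/contracted_cl_sym.
have SM h h' : S h -> S h' -> S (h * h')%g.
  move=> [h1 hx] [h1' hx']; split; first by rewrite DeltaM h1 h1' mulr1.
  rewrite actM; apply: contracted_cl_trans hx; apply: contracted_cl_act => //.
  by rewrite h1.
have sS : is_subgroup S.
  split; first by split; [exact: Delta1|rewrite act1 => ? _].
  by move=> h h' /SV hh hh'; apply: SM.
have tm m : contracted_cl rho x0 (act (t ^+ m)%g x0).
  elim: m => [|m IH]; first by rewrite act1 => ? _.
  rewrite expgS actM; apply: contracted_cl_trans hrho _.
  by apply: contracted_cl_act => //; exact: ltW.
have St h : S h -> S (t * h * t^-1)%g.
  move=> [h1 hx].
  have e1 : Delta (t * h * t^-1)%g = 1.
    by rewrite !DeltaM DeltaV h1 mulr1 mulfV // lt0r_neq0 // Delta_gt0.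
  split => //.
  have := @contracted_cl_act rho (t * h * t^-1)%g _ _ _ hrho.
  have -> : act (t * h * t^-1)%g (act t x0) = act t (act h x0) by rewrite -!actM mulgVK.
  rewrite e1 lexx => /(_ isT) h2.
  apply: contracted_cl_trans h2 _; apply: contracted_cl_trans (contracted_cl_sym hrho).
  by apply: contracted_cl_act => //; exact: ltW.
(* [m] is chosen so that [Delta (t ^+ m)] exceeds the bound of [Delta] on coarser scales. Then
   [t ^+ m] contracts [n x0] and [x0] enough, and [tm] compares the result with [x0]. *)
have Sbig n : Delta n = 1 -> exists m, S (t ^+ m * n * (t ^+ m)^-1)%g.
  move=> n1; have [I hI] := cl_ex (act n x0) x0.
  have [C1 hC1] := Delta_le (rho + C + k - I).
  have [m hm] := exp_unbounded C1%:R t1.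
  have tI : rho + C + k - I <= sigma (t ^+ m)%g.
    by apply/ltW; rewrite ltNge; apply/negP => /hC1; rewrite DeltaX leNgt hm.
  have e1 : Delta (t ^+ m * n * (t ^+ m)^-1)%g = 1.
    by rewrite !DeltaM DeltaV n1 mulr1 mulfV // lt0r_neq0 // Delta_gt0.
  exists m; split => //.
  have := @contracted_cl_act rho (t ^+ m * n * (t ^+ m)^-1)%g _ _ _ (tm m).
  have -> : act (t ^+ m * n * (t ^+ m)^-1)%g (act (t ^+ m)%g x0) = act (t ^+ m)%g (act n x0).
    by rewrite -!actM mulgVK.
  rewrite e1 lexx => /(_ isT) h2.
  apply: contracted_cl_trans h2 _; apply: contracted_cl_trans (contracted_cl_sym (tm m)).
  by apply: hC; apply: clW (cl_act (t ^+ m)%g hI) _; sigma_lia.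
have [Cs hCs] : exists C : int, forall h, S h -> `|sigma h| <= C.
  have [C1 [_ hC1]] := Delta_sigma_ge; have [C2 hC2] := Delta_sigma_le 1.
  exists (`|C1| + `|C2|) => h [h1 _].
  have := hC1 h; have := hC2 h; rewrite h1 lexx => /(_ isT) ? /(_ isT) ?; sigma_lia.
exists S, t; split => //.
  move=> m [h1 _]; apply/eqP; rewrite -leqn0 leqNgt; apply/negP => m0.
  have : 1 < Delta (t ^+ m)%g by rewrite DeltaX exprn_egt1 // -lt0n.
  by rewrite h1 ltxx.
split.
(* Dividing by a power of [t] lands in the kernel of [Delta], and [Sbig] conjugates the result into
   [S]. *)
- move=> g; have [g1|/ltW g1] := leP 1 (Delta g).
    have [b hb] := Delta_power t1 tmin g1.
    have [|m hm] := Sbig (g * (t ^+ b)^-1)%g.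
      by rewrite DeltaM DeltaV DeltaX -hb mulfV // lt0r_neq0 // Delta_gt0.
    exists m, (m + b)%N, (t ^+ m * (g * (t ^+ b)^-1) * (t ^+ m)^-1)%g; split => //.
    by rewrite expgnDr; gsimp.
  have g1' : 1 <= Delta g^-1%g by rewrite DeltaV -invr1 lef_pV2 ?posrE ?Delta_gt0.
  have [b hb] := Delta_power t1 tmin g1'.
  have [|m hm] := Sbig (t ^+ b * g)%g.
    by rewrite DeltaM DeltaX -hb DeltaV mulVf // lt0r_neq0 // Delta_gt0.
  exists (m + b)%N, m, (t ^+ m * (t ^+ b * g) * (t ^+ m)^-1)%g; split => //.
  by rewrite expgnDr; gsimp.
(* [h] is labelled by a net point near [h t x0]. The net is so fine that pulling back by [h * t]
   leaves scale [rho + C], which [hC] upgrades to [contracted_cl rho]. *)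
- have [r [p hp]] := cl_net (rho + C + Cs + `|sigma t| + 10 * k) rho x0.
  have Sp h : S h -> exists i, cl (rho + C + Cs + `|sigma t| + 10 * k) (p i) (act (h * t)%g x0).
    move=> [h1 hx]; apply/hp/contracted_clW; rewrite actM.
    apply: contracted_cl_trans (contracted_cl_sym hx) _.
    by apply: contracted_cl_act => //; rewrite h1.
  pose c h := if pselect (S h) is left Sh then Some (projT1 (cid (Sp h Sh))) else None.
  exists (option 'I_r), c => h h' Sh Sh'; rewrite /c.
  case: pselect => // Sh1; case: pselect => // Sh1'.
  case: cid => i /= hi; case: cid => j /= hj [ij]; subst j.
  split; first by rewrite 3!DeltaM !DeltaV Sh.1 Sh'.1 invr1 !mulr1 mulVf // lt0r_neq0 // Delta_gt0.
  apply: hC; have := sigmaM_le h t; have := hCs _ Sh => ? ?.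
  apply: cl_sym; apply: clW (cl_actV (g := (h * t)%g)
    (I := rho + C + Cs + `|sigma t| + 10 * k) _) _; last by sigma_lia.
    rewrite -actM; have -> : (h * t * (t^-1 * (h^-1 * h') * t) = h' * t)%g.
      by gsimp.
    exact: cl_trans (cl_sym hi) hj.
by exists Cs.
Qed.

End CoarseSimilarity.

(** * Presentations of ascending HNN extensions *)

Section AscendingHNNPresentation.
Variables (G : groupType) (S : {pred G}) (H : subGroupType S) (t : G) (phi : H -> H).
Hypothesis val_phi : forall h, val (phi h) = t * val h * t^-1.
Hypothesis expt_inj : forall m, t ^+ m \in S -> m = 0%N.
Hypothesis normal_form :
  forall g, exists a b (h : H), g = (t ^+ a)^-1 * val h * t ^+ b.

Local Notation "u ~~ v" := (pres_eq (hnn_rel phi) u v) (at level 70).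
Local Notation tp := (None : option H, true).
Local Notation tn := (None : option H, false).
Local Notation el h := (Some h : option H, true).
Let gen (x : option H) : G := if x is Some h then val h else t.

Lemma pres_catl (w u v : word (option H)) : u ~~ v -> w ++ u ~~ w ++ v.
Proof. by apply: pres_cat; exact: pres_refl. Qed.

Lemma pres_catr (w u v : word (option H)) : u ~~ v -> u ++ w ~~ v ++ w.
Proof. by move=> h; apply: pres_cat => //; exact: pres_refl. Qed.

Lemma pres_one : [:: el 1] ~~ [::].
Proof.
have := pres_catr [:: (Some 1, false)] (pres_rel (hnn_mul phi 1 1)).
rewrite mulg1 /= => h.
apply: (pres_trans (pres_sym (pres_catl [:: el 1] (pres_cancel _ (Some 1) true)))).
exact: pres_trans h (pres_cancel _ (Some 1) true).
Qed.

Lemma pres_inv h : [:: (Some h, false)] ~~ [:: el h^-1].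
Proof.
apply: (pres_trans (pres_sym (pres_catl [:: (Some h, false)] pres_one))).
have e := pres_rel (hnn_mul phi h h^-1); rewrite mulgV in e.
apply: (pres_trans (pres_sym (pres_catl [:: (Some h, false)] e))).
exact (pres_catr [:: el h^-1] (pres_cancel _ (Some h) false)).
Qed.

Lemma pres_push_t h : [:: tp; el h] ~~ [:: el (phi h); tp].
Proof.
apply: (pres_trans (pres_sym (pres_catl [:: tp; el h] (pres_cancel _ None false)))).
exact (pres_catr [:: tp] (pres_rel (hnn_conj phi h))).
Qed.

Lemma pres_push_tV h : [:: el h; tn] ~~ [:: tn; el (phi h)].
Proof.
apply: (pres_trans (pres_sym (pres_catr [:: el h; tn] (pres_cancel _ None false)))).
exact (pres_catl [:: tn] (pres_rel (hnn_conj phi h))).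
Qed.

Lemma pres_push_exp b h : nseq b tp ++ [:: el h] ~~ el (iter b phi h) :: nseq b tp.
Proof.
elim: b => [|b IH]; first exact: pres_refl.
apply: pres_trans (pres_catl [:: tp] IH) _.
exact (pres_catr (nseq b tp) (pres_push_t (iter b phi h))).
Qed.

Definition hnn_word a h b : word (option H) :=
  nseq a tn ++ el h :: nseq b tp.

Lemma nseq_rcons (T : Type) n (x : T) : nseq n x ++ [:: x] = x :: nseq n x.
Proof. by rewrite cats1; elim: n => //= n ->. Qed.

(** Insert [t^-1 t] before [h] and push [t] to the right. This serves to bring two normal forms to a
    common left exponent. *)
Lemma hnn_word_raise a h b : hnn_word a h b ~~ hnn_word a.+1 (phi h) b.+1.
Proof.
have e : [:: el h] ~~ [:: tn; el (phi h); tp].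
  apply: (pres_trans (pres_sym (pres_catr [:: el h] (pres_cancel _ None false)))).
  exact (pres_catl [:: tn] (pres_push_t h)).
have := pres_catl (nseq a tn) (pres_catr (nseq b tp) e).
by rewrite /hnn_word -[nseq a.+1 tn]nseq_rcons -catA.
Qed.

Lemma hnn_word_raisen c a h b :
  hnn_word a h b ~~ hnn_word (c + a) (iter c phi h) (c + b).
Proof.
elim: c => [|c IH]; first exact: pres_refl.
exact: pres_trans IH (hnn_word_raise _ _ _).
Qed.

Lemma hnn_word_el a h b k :
  hnn_word a h b ++ [:: el k] ~~ hnn_word a (h * iter b phi k) b.
Proof.
rewrite /hnn_word -catA cat_cons.
apply: pres_trans (pres_catl _ (pres_catl [:: el h] (pres_push_exp b k))) _.
exact (pres_catl _ (pres_catr (nseq b tp) (pres_rel (hnn_mul phi h _)))).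
Qed.

(** Normal forms are stable under appending a letter. Only [t^-1] with [b = 0] changes [a]: it moves
    left across [h], which becomes [phi h]. *)
Lemma pres_hnn_word w : exists a h b, w ~~ hnn_word a h b.
Proof.
elim/last_ind: w => [|w l [a [h [b IH]]]].
  by exists 0%N, 1, 0%N; apply/pres_sym/pres_one.
have {IH} := pres_catr [:: l] IH; rewrite cats1 => IH.
case: l IH => [[k|] []] IH.
- by exists a, (h * iter b phi k), b; apply: pres_trans IH (hnn_word_el _ _ _ _).
- exists a, (h * iter b phi k^-1), b; apply: pres_trans IH _.
  exact: pres_trans (pres_catl _ (pres_inv k)) (hnn_word_el _ _ _ _).
- exists a, h, b.+1; apply: pres_trans IH _.
  by rewrite /hnn_word -catA cat_cons nseq_rcons; apply: pres_refl.
case: b IH => [|b] IH.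
  exists a.+1, (phi h), 0%N; apply: pres_trans IH _.
  rewrite /hnn_word -catA -[nseq a.+1 tn]nseq_rcons -catA.
  exact (pres_catl _ (pres_push_tV h)).
exists a, h, b; apply: pres_trans IH _.
rewrite /hnn_word -[nseq b.+1 tp]nseq_rcons -catA cat_cons -catA -[X in _ ~~ _ ++ _ :: X]cats0.
exact (pres_catl _ (pres_catl [:: el h] (pres_catl (nseq b tp) (pres_cancel _ None true)))).
Qed.

Lemma word_eval_cat (u v : word (option H)) :
  word_eval gen (u ++ v) = word_eval gen u * word_eval gen v.
Proof. exact: big_cat. Qed.

Lemma word_eval_hnn_word a h b :
  word_eval gen (hnn_word a h b) = (t ^+ a)^-1 * val h * t ^+ b.
Proof.
rewrite /hnn_word word_eval_cat {2}/word_eval big_cons mulgA.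
congr (_ * _ * _); last by rewrite big_nseq iter_mulg mulg1.
by rewrite /word_eval big_nseq iter_mulg mulg1 expVgn.
Qed.

Lemma word_eval_pres u v : u ~~ v -> word_eval gen u = word_eval gen v.
Proof.
elim=> //.
- by move=> {}u {}v w _ -> _ ->.
- by move=> {}u u' {}v v' _ e _ e'; rewrite !word_eval_cat e e'.
- by move=> x [] /=; rewrite /word_eval big_cons big_seq1 /= big_nil ?mulgV ?mulVg.
move=> _ _ [h k|h]; rewrite /word_eval !big_cons !big_nil /= ?mulg1.
  by rewrite valM.
by rewrite val_phi mulgA.
Qed.

Theorem ascending_hnn_decompositionP : ascending_hnn_decomposition t phi.
Proof.
split=> [g|u v].
  have [a [b [h ->]]] := normal_form g.
  by exists (hnn_word a h b); exact: word_eval_hnn_word.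
split; last exact: word_eval_pres.
have [a [h [b hu]]] := pres_hnn_word u; have [a' [h' [b' hv]]] := pres_hnn_word v.
(* Both words are raised to left exponent [a + a'], so that the left factors cancel in [G]. *)
have {hu} hu := pres_trans hu (hnn_word_raisen a' _ _ _).
have {hv} hv := pres_trans hv (hnn_word_raisen a _ _ _).
rewrite addnC in hv.
move: (a' + a)%N (a' + b)%N (a + b')%N (iter _ _ _) (iter _ _ _) hu hv
  => {}a {}b {}b' {}h {}h' hu hv.
rewrite -/gen (word_eval_pres hu) (word_eval_pres hv) !word_eval_hnn_word -!mulgA.
move=> /mulgI e.
suff bb : b = b'.
  subst b'; move/mulIg/val_inj: e => e; subst h'.
  exact: pres_trans hu (pres_sym hv).
(* A difference [c] of the right exponents would put [t ^+ c] in [S]. *)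
have H1 c (k k' : H) b1 : val k * t ^+ (c + b1) = val k' * t ^+ b1 -> c = 0%N.
  rewrite expgnDr mulgA => /mulIg e1; apply: expt_inj.
  have -> : t ^+ c = val (k^-1 * k') by rewrite valM gmulfV -e1 mulgA mulVg mul1g.
  exact: valP.
have [bb|bb] := leqP b b'.
  by have := subnK bb; move/esym: e; rewrite -{1}(subnK bb) => /H1 ->.
by have := subnK (ltnW bb); move: e; rewrite -{1}(subnK (ltnW bb)) => /H1 ->.
Qed.

End AscendingHNNPresentation.

(** * From a subgroup given as a set to a group type *)

Section SubgroupType.
Variables (G : groupType) (A : set G) (hA : is_subgroup A).

Definition set_pred : {pred G} := fun x => `[< A x >].

Fact set_pred_closed : group_closed set_pred.
Proof.
split=> [|x y]; rewrite !unfold_in => /=; first exact/asboolP/hA.1.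
move=> /asboolP Ax /asboolP Ay; apply/asboolP.
exact: subgroupM hA Ax (subgroupV hA Ay).
Qed.

(* The phantom proof lets the group structure be inferred from the type. *)
Record subgroup_of (hB : is_subgroup A) :=
  SubgroupOf { subgroup_val : G; _ : set_pred subgroup_val }.

HB.instance Definition _ := [isSub of subgroup_of hA for @subgroup_val hA].
HB.instance Definition _ := [Choice of subgroup_of hA by <:].
HB.instance Definition _ :=
  SubChoice_isSubGroup.Build G set_pred (subgroup_of hA) set_pred_closed.

Notation gval := (@subgroup_val hA).

Lemma subgroup_valP h : A (gval h).
Proof. exact/asboolP/(valP h). Qed.

Lemma subgroup_val_inj : injective gval.
Proof. exact: val_inj. Qed.

Lemma subgroup_valM x y : gval (x * y) = gval x * gval y.
Proof. exact: (@valM _ _ (subgroup_of hA)). Qed.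

Variables (t : G) (At : forall h, A h -> A (t * h * t^-1)).

Definition subgroup_conj (h : subgroup_of hA) : subgroup_of hA :=
  SubgroupOf hA (introT (asboolP _) (At (subgroup_valP h))).

Fact subgroup_conjM : {morph subgroup_conj : x y / x * y}.
Proof.
move=> x y; apply: subgroup_val_inj.
by rewrite subgroup_valM /=; gsimp.
Qed.

HB.instance Definition _ :=
  isMultiplicative.Build _ _ subgroup_conj subgroup_conjM.

Lemma subgroup_conj_inj : injective (subgroup_conj).
Proof.
move=> x y /(congr1 gval) /= /mulIg /mulgI.
exact: subgroup_val_inj.
Qed.

Lemma finite_index_subgroup_conj (T : finType) (c : G -> T) :
  (forall h h', A h -> A h' -> c h = c h' -> A (t^-1 * (h^-1 * h') * t)) ->
  finite_index (range subgroup_conj).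
Proof.
move=> hc.
pose coset (h : subgroup_of hA) := [set h * a | a in range subgroup_conj].
(* A label is sent to the coset of any element carrying it, and to the default [set0] if there is
   none. *)
pose F (i : T) := xget set0 [set B | exists h, c (gval h) = i /\ B = coset h].
apply: (@sub_finite_set _ _ (F @` setT)); last exact: finite_image.
move=> _ [h _ <-]; exists (c (gval h)) => //.
rewrite /F; case: xgetP => [_ _ [h' [chh' ->]]|/(_ (coset h)) []]; last by exists h.
have key h1 h2 : c (gval h1) = c (gval h2) -> coset h1 `<=` coset h2.
  move=> c12 _ [_ [a _ <-] <-].
  have Ab : A (t^-1 * ((gval h2)^-1 * gval h1) * t).
    by apply: hc; rewrite ?c12 //; exact: subgroup_valP.
  pose b := SubgroupOf hA (introT (asboolP _) Ab).
  exists (subgroup_conj (b * a)); first by exists (b * a).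
  by apply: subgroup_val_inj; rewrite !subgroup_valM /=; gsimp.
by apply/seteqP; split; apply: key.
Qed.

End SubgroupType.

(** * Digits and distances in Q_n *)

Section QnDigits.
Local Open Scope ring_scope.
Variables (R : realType) (n : nat) (hn : (1 < n)%N).
Local Notation X := (Qn R hn).
Implicit Types (x y z : X) (I J : int).

Definition agree I x y : Prop := agree_upto x y I.

Lemma agree_refl I x : agree I x x. Proof. by []. Qed.

Lemma agree_sym I x y : agree I x y -> agree I y x.
Proof. by move=> h i /h. Qed.

Lemma agree_trans I x y z : agree I x y -> agree I y z -> agree I x z.
Proof. by move=> h h' i iI; rewrite h // h'. Qed.

Lemma agreeW I J x y : agree I x y -> J <= I -> agree J x y.
Proof. by move=> h JI i iJ; apply: h; apply: le_trans iJ JI. Qed.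

Lemma agree_ex x y : exists I, agree I x y.
Proof.
have [a ha] := digit_eventually0 x; have [b hb] := digit_eventually0 y.
by exists (- `|a| - `|b| - 1) => i hi; rewrite ha ?hb //; lia.
Qed.

Let n1 : 1 < n%:R :> R. Proof. by rewrite ltr1n. Qed.
Let n0 : 0 < n%:R :> R. Proof. exact: lt_trans n1. Qed.

Lemma mdist_agree x y : x <> y ->
  exists v : int, mdist x y = n%:R ^ (- v) /\ forall I, agree I x y <-> I <= v.
Proof.
move=> /eqP xy; have [h1 h2] := agreeP xy.
exists (xget 0 [set I | is_greatest (agree_upto x y) I]); split.
  by rewrite /mdist /= /Qn_dist (negPf xy).
by move=> I; split => [/h2//|]; apply: agreeW h1.
Qed.

Lemma agree_of_mdist I x y : mdist x y <= n%:R ^ (- I) -> agree I x y.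
Proof.
have [->//|/eqP xy] := eqVneq x y.
by have [v [-> hv]] := mdist_agree xy; rewrite ler_eXz2l // lerN2 hv.
Qed.

Lemma mdist_of_agree I x y : agree I x y -> mdist x y <= n%:R ^ (- I).
Proof.
have [->|/eqP xy] := eqVneq x y; first by rewrite mdistxx exprz_ge0 // ltW.
by have [v [-> hv]] := mdist_agree xy; rewrite ler_eXz2l // lerN2 hv.
Qed.

Fact Qn0_subproof : exists k : int, forall i, i < k -> (0 : 'Z_n) = 0.
Proof. by exists 0. Qed.

Definition Qn0 : X := MkQn R hn Qn0_subproof.

Definition set_digit x (j : int) (a : 'Z_n) (i : int) : 'Z_n :=
  if i == j then a else x i.

Fact set_digit_subproof x j a :
  exists k : int, forall i, i < k -> set_digit x j a i = 0.
Proof.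
have [k hk] := digit_eventually0 x; exists (- `|k| - `|j|) => i hi.
by rewrite /set_digit ifF ?hk //; [lia|apply/eqP; lia].
Qed.

Definition upd x j a : X := MkQn R hn (set_digit_subproof x j a).

Lemma agree_upd x j I a : agree I x (upd x j a) <-> I < j \/ a = x j.
Proof.
split=> [h|h i iI]; last first.
  rewrite /= /set_digit; case: eqP => // ij; subst i.
  by case: h => [|//]; rewrite ltNge iI.
have [|jI] := ltP I j; first by left.
by right; rewrite (h j jI) /= /set_digit eqxx.
Qed.

Lemma neq_upd x j : exists y, forall I, agree I x y <-> I < j.
Proof.
exists (upd x j (x j + 1)) => I; rewrite agree_upd; split=> [[//|]|]; last by left.
move=> /eqP; rewrite -subr_eq0 addrAC subrr add0r.
by rewrite (negPf (oner_neq0 _)).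
Qed.

Lemma agree_far I (m : nat) : exists z : 'I_m -> X,
  forall i j, agree I (z i) (z j) -> i = j.
Proof.
exists (fun i => upd Qn0 (I - i%:Z) 1) => i j h.
have := h (I - i%:Z); rewrite /= /set_digit eqxx.
case: eqP => [e _|_ h'].
  by apply/val_inj => /=; lia.
have /eqP : (1 : 'Z_n) = 0 by apply: h'; lia.
by rewrite (negPf (oner_neq0 _)).
Qed.

Definition patch x J N (f : {ffun 'I_N.+1 -> 'Z_n}) (i : int) : 'Z_n :=
  if i <= J then x i
  else if i <= J + N%:Z then f (inord `|i - J|) else 0.

Fact patch_subproof x J N (f : {ffun 'I_N.+1 -> 'Z_n}) :
  exists k : int, forall i, i < k -> patch x J f i = 0.
Proof.
have [k hk] := digit_eventually0 x; exists (- `|k| - `|J|) => i hi.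
by rewrite /patch ifT ?hk //; lia.
Qed.

Lemma agree_net I J x : exists (m : nat) (p : 'I_m -> X),
  forall y, agree J x y -> exists i, agree I (p i) y.
Proof.
pose N := (`|I - J|)%N.
pose F := {ffun 'I_N.+1 -> 'Z_n}.
exists #|{: F}|, (fun i => MkQn R hn (patch_subproof x J (enum_val i : F))).
move=> y xy; exists (enum_rank ([ffun k : 'I_N.+1 => y (J + k%:Z)] : F)).
move=> i iI; rewrite /= /patch enum_rankK ffunE.
case: leP => [iJ|Ji]; first exact: xy.
rewrite ifT; last by rewrite /N; lia.
by rewrite inordK; [congr (digit y _); lia|rewrite /N ltnS; lia].
Qed.

Lemma compact_agree (D : set (X * X)) : compact D -> D `<=` @distinct_pairs R X ->
  exists m : nat, forall p q, D (p, q) ->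
    [/\ ~ agree (m%:Z + 1) p q, agree (- m%:Z) Qn0 p & agree (- m%:Z) p q].
Proof.
move=> /compact_near_coveringP Dc Dd.
pose P (m : nat) (pq : X * X) := [/\ ~ agree (m%:Z + 1) pq.1 pq.2,
   agree (- m%:Z) Qn0 pq.1 & agree (- m%:Z) pq.1 pq.2].
(* Bounds valid near each pair for all large [m] become one bound on [D] by compactness. *)
have [] := Dc nat \oo P _.
  move=> [p q] /Dd /= pq.
  have [v [_ hv]] := mdist_agree pq.
  have [e he] := agree_ex Qn0 p.
  (* Agreement up to [m0] preserves the exact level [v] at which [p] and [q] agree, and the level
     [e] relative to [Qn0]. *)
  pose m0 := (`|v| + `|e| + 1)%N.
  pose r : R := n%:R ^ (- m0%:Z).
  have r0 : 0 < r by rewrite exprz_gt0.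
  exists ((ball p r `*` ball q r), [set m | (m0 <= m)%N]).
    split; last by exists m0.
    by exists (ball p r, ball q r) => //; split; apply: nbhsx_ballx.
  move=> [[p' q'] m] /= [[]]; rewrite !ballEmdist /= => hp hq hm.
  have {}hp := agree_of_mdist (ltW hp).
  have {}hq := agree_of_mdist (ltW hq).
  split=> /=.
  - move=> h; suff : agree (v + 1) p q by rewrite hv; lia.
    apply: agree_trans (agreeW hp _) (agree_trans (agreeW h _) (agree_sym (agreeW hq _)));
      rewrite /m0; lia.
  - by apply: agree_trans (agreeW he _) (agreeW hp _); rewrite /m0; lia.
  apply: agree_trans (agree_sym (agreeW hp _)) (agree_trans _ (agreeW hq _)); rewrite ?/m0; try lia.
  by apply/hv; lia.
move=> m _ /(_ m) /= H; exists m => p q Dpq.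
exact: (H (leqnn m) (p, q)).
Qed.

(** The pair [x'], [y'] at distance 1 is a reference. The ratio inequality, used with the two pairs
    in either order, gives after logarithms to base [n] the shift of any other pair up to [k]. *)
Lemma quasisimilarity_agree (f : X -> X) (K : R) (k : nat) x y x' y' v :
  K <= n%:R ^+ k -> quasisimilarity K f -> x <> y -> x' <> y' ->
  (forall I, agree I x' y' <-> I <= 0) ->
  (forall I, agree I (f x') (f y') <-> I <= v) ->
  forall I, (agree I x y -> agree (I + v - k%:Z) (f x) (f y)) /\
    (agree I (f x) (f y) -> agree (I - v - k%:Z) x y).
Proof.
move=> Kk [/bij_inj finj hf] xy xy' h' hv I.
have fxy : f x <> f y by move=> /finj.
have fxy' : f x' <> f y' by move=> /finj.
have [a [da ha]] := mdist_agree xy; have [b [db hb]] := mdist_agree fxy.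
have [c [dc hc]] := mdist_agree xy'; have [d [dd hd]] := mdist_agree fxy'.
have c0 : c = 0.
  by have := (h' c).1 ((hc c).2 (lexx _)); have := (hc 0).1 ((h' 0).2 (lexx _)); lia.
have dv : d = v.
  by have := (hv d).1 ((hd d).2 (lexx _)); have := (hd v).1 ((hv v).2 (lexx _)); lia.
subst c d.
have e (p q r s : int) :
    (n%:R ^ (- p) / n%:R ^ (- q)) / (n%:R ^ (- r) / n%:R ^ (- s)) <= n%:R ^+ k :> R ->
    - p + q + r - s <= k%:Z.
  have nz : (n%:R : R) != 0 by rewrite lt0r_neq0.
  rewrite !invr_expz !opprK -!expfzDr // invr_expz -expfzDr // -[n%:R ^+ k]/(n%:R ^ k%:Z).
  by rewrite ler_eXz2l //; lia.
have := le_trans (hf _ _ _ _ xy xy') Kk; have := le_trans (hf _ _ _ _ xy' xy) Kk.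
rewrite da db dc dd => /e h1 /e h2.
by rewrite !ha !hb; split; lia.
Qed.

Lemma mdist_le_agree (C : nat) x y x' y' :
  (forall I, agree I x y -> agree (I - C%:Z) x' y') ->
  mdist x' y' <= n%:R ^+ C * mdist x y.
Proof.
move=> h; have [e|/eqP xy] := eqVneq x y.
  have [->|/eqP xy'] := eqVneq x' y'; first by rewrite mdistxx mulr_ge0 ?mdist_ge0 ?exprn_ge0 ?ltW.
  have [v [_ hv]] := mdist_agree xy'.
  have /h : agree (v + 1 + C%:Z) x y by rewrite e.
  by rewrite hv; lia.
have [v [-> hv]] := mdist_agree xy.
have /h /mdist_of_agree h' := (hv v).2 (lexx _).
apply: le_trans h' _; rewrite -[n%:R ^+ C]/(n%:R ^ C%:Z) -expfzDr ?lt0r_neq0 //.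
by rewrite ler_eXz2l //; lia.
Qed.

End QnDigits.

(** * From quasisimilarities to coarse similarities *)

Lemma uniform_quasisimilarity_scale (R : realType) (n : nat) (hn : (1 < n)%N)
    (G : Type) (act : G -> Qn R hn -> Qn R hn) (K : R) (x0 y0 : Qn R hn) :
  (forall g, quasisimilarity K (act g)) ->
  (forall I, agree I x0 y0 <-> (I <= 0)%R) ->
  exists (k : nat) (sigma : G -> int), forall g I x y,
    (agree I x y -> agree (I + sigma g - k%:Z)%R (act g x) (act g y)) /\
    (agree I (act g x) (act g y) -> agree (I - sigma g - k%:Z)%R x y).
Proof.
move=> qs hxy.
have xy0 : x0 <> y0.
  by move=> e; have := (hxy 1%R).1; rewrite e => /(_ (agree_refl _)).
have inj g : injective (act g) by case: (qs g) => /bij_inj.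
have /choice [sigma hs] g : exists v : int,
    forall I, agree I (act g x0) (act g y0) <-> (I <= v)%R.
  have [v [_ hv]] := @mdist_agree _ _ _ (act g x0) (act g y0) (fun e => xy0 (inj _ _ _ e)).
  by exists v.
pose k := Num.bound K; exists k, sigma => g I x y.
(* Through [K <= 2 ^ k <= n ^ k]. *)
have Kk : (K <= n%:R ^+ k)%R.
  apply: le_trans (ltW (upper_nthrootP (leqnn k))) _.
  by rewrite lerXn2r ?nnegrE ?ler0n // ler_nat.
have [->|/eqP xy] := eqVneq x y; first by split=> _; exact: agree_refl.
exact: quasisimilarity_agree Kk (qs g) xy xy0 hxy (hs g) I.
Qed.

Theorem corollary8 (R : realType) (n : nat) (hn : (2 <= n)%N)
    (G : groupType) (act : G -> Qn R hn -> Qn R hn)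
    (act_uqs : uniform_quasisimilarity_action act)
    (act_cocompact : cocompact_on_distinct_pairs act) :
  exists (S : {pred G}) (H : subGroupType S) (t : G)
         (phi : {multiplicative H -> H}),
    [/\ ascending_hnn_decomposition t phi,
        injective phi,
        finite_index (range phi) &
        uniformly_bilipschitz (fun h : H => act (val h))].
Proof.
have [[act1 actM] [K [_ qs]]] := act_uqs.
pose x0 := Qn0 R hn.
have [y0 hy0] := neq_upd x0 1%R.
have hxy I : agree I x0 y0 <-> (I <= 0)%R by rewrite hy0; lia.
have [k [sigma hs]] := uniform_quasisimilarity_scale qs hxy.
have actD g I x y := (hs g I x y).1; have actU g I x y := (hs g I x y).2.
have [D [Dc Dd Dcov]] := act_cocompact.
have [m hm] := compact_agree Dc Dd.
(* A pair [(x, y)] agreeing exactly up to [j] is the image of some [(p, q)] in [D], whose level lies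
   between [-m] and [m]; hence [sigma g] is [j] up to [m + k]. As [x0] and [p] agree up to [-m],
   [g x0] is close to [x]. *)
have cob x (j : int) : exists g,
    [/\ (j - (3 * m + 3 * k)%N%:Z <= sigma g)%R, (sigma g <= j + (3 * m + 3 * k)%N%:Z)%R &
        agree (j - (3 * m + 3 * k)%N%:Z)%R (act g x0) x].
  have [y hy] := neq_upd x (j + 1)%R.
  have [|g [[p q] [/= Dpq [ep eq]]]] := Dcov (x, y).
    by move=> /= e; have := (hy (j + 1)%R).1; rewrite -e => /(_ (agree_refl _)); rewrite ltxx.
  have [h1 h2 h3] := hm _ _ Dpq; exists g.
  have s1 : (sigma g <= j + m%:Z + k%:Z)%R.
    by have := actD g _ _ _ h3; rewrite -ep -eq hy; lia.
  have s2 : (j - m%:Z - k%:Z <= sigma g)%R.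
    have : agree j (act g p) (act g q) by rewrite -ep -eq hy; lia.
    rewrite leNgt => /actU h; apply/negP => s; apply: h1.
    by apply: agreeW h _; lia.
  split; [lia|lia|].
  by rewrite ep; apply: agreeW (actD g _ _ _ h2) _; lia.
have [A [t [hA At texp [normal [T [c hc]] [C hC]]]]] :=
  coarse_hnn act1 actM (@agree_refl R n hn) (@agree_sym R n hn) (@agree_trans R n hn)
    (@agreeW R n hn) (@agree_ex R n hn) (@agree_net R n hn) (@agree_far R n hn)
    (isT : (0 <= k%:Z)%R) actD actU ((hxy _).2 (lexx _)) (fun h => ltac:(by move/hxy: h))
    (isT : (0 <= (3 * m + 3 * k)%N%:Z)%R) cob.
exists (set_pred A), (subgroup_of hA), t, (subgroup_conj At).
split.
- apply: ascending_hnn_decompositionP.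
  + by [].
  + by move=> j /asboolP/texp.
  + move=> g; have [a [b [h [Ah ->]]]] := normal g.
    by exists a, b, (SubgroupOf hA (introT (asboolP _) Ah)).
- exact: subgroup_conj_inj.
- exact: finite_index_subgroup_conj hc.
(* [C] bounds the scales on the subgroup, and [k] is the error in [actD] and [actU]. *)
exists (n%:R ^+ (`|C| + k))%R; split; first by rewrite exprn_ege1 // ler1n ltnW.
move=> h x y; have Ch : (`|sigma (val h)| <= C)%R := hC _ (subgroup_valP h).
move: (val h : G) Ch => {}h Ch.
have L0 : (0 < n%:R ^+ (`|C| + k) :> R)%R by rewrite exprn_gt0 // ltr0n ltnW.
apply/andP; split.
  rewrite ler_pdivrMl //; apply: mdist_le_agree => I /actU /agreeW; apply.
  by lia.
by apply: mdist_le_agree => I /actD /agreeW; apply; lia.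
Qed.
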